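(* Let $A$ be a real finite-dimensional affine space and $m\in\mathrm{Met}(A)$ a metric with hessian principal component $g_m\in S^2\vec A^*$. The mapping $\widehat\delta\mapsto\widehat\delta\circ v$, obtained by composition with the quadratic mapping $v:A\to\mathrm{Aff}(\mathrm{Quad}_mA)$, $P\mapsto v_P$, is a linear mapping $\widehat{\mathrm{Quad}_mA}\to\mathrm{Quad}(A)$. The restriction of this linear mapping to the hyperplane $\mathrm{Quad}_mA\subset\widehat{\mathrm{Quad}_mA}$ is the natural immersion $\mathrm{Quad}_mA\hookrightarrow\mathrm{Quad}(A)$, and the hessian principal component of $\widehat\delta\circ v\in\mathrm{Quad}(A)$ is $\langle\widehat\delta,v_m\rangle\cdot g_m$, for any $\widehat\delta\in\widehat{\mathrm{Quad}_mA}$.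
   Context: All spaces are real and finite-dimensional. $A$ has director vector space $\vec A$; $\mathrm{Aff}(A)$ is the vector space of affine functions $A\to\mathbb R$. A map $\delta:A\to B$ between affine spaces is quadratic if $\delta(\alpha P+\beta Q)=\alpha(\alpha-\beta)\delta(P)+\beta(\beta-\alpha)\delta(Q)+4\alpha\beta\,\delta(\frac{P+Q}2)$ for all $P,Q\in A$ and $\alpha+\beta=1$; $\mathrm{Quad}(A)$ is the vector space of quadratic functions $A\to\mathbb R$. Each $\delta\in\mathrm{Quad}(A)$ has a symmetric bilinear form $\mathrm{Hess}\,\delta\in S^2\vec A^*$ on $\vec A$ (its hessian principal component), characterized by $\frac12(\delta(Q)+\delta(2P-Q))-\delta(P)=\frac12\mathrm{Hess}\,\delta(\overrightarrow{PQ},\overrightarrow{PQ})$ for all $P,Q\in A$. $\mathrm{Met}(A)=\mathrm{Quad}(A)/\mathrm{Aff}(A)$ is the space of metrics; for $m\in\mathrm{Met}(A)$, $\mathrm{Quad}_mA\subset\mathrm{Quad}(A)$ is the class $m$, an affine space with director space $\mathrm{Aff}(A)$; its elements share the same hessian principal component $g_m$ (that of $m$). $\mathrm{Aff}(\mathrm{Quad}_mA)$ is the vector space of affine functionals $\mathrm{Quad}_mA\to\mathbb R$; elements: $v_P(\delta)=\delta(P)$ for $P\in A$, and $v_m(\delta)=1$. Its dual space is the linear hull $\widehat{\mathrm{Quad}_mA}$, in which $\mathrm{Quad}_mA$ is embedded by evaluation ($\langle\delta,\bar v\rangle=\bar v(\delta)$) as the affine hyperplane $\{\langle\cdot,v_m\rangle=1\}$.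 For $\widehat\delta\in\widehat{\mathrm{Quad}_mA}$, $(\widehat\delta\circ v)(P)=\langle\widehat\delta,v_P\rangle$. *)

(* Defs.v *)
From HB Require Import structures.
From mathcomp Require Import all_boot all_order all_algebra.
From mathcomp Require Import sesquilinear ring_quotient generic_quotient.
From mathcomp Require Import boolp functions reals.
From mathcomp Require Import ring lra.

Set Implicit Arguments.
Unset Strict Implicit.
Unset Printing Implicit Defensive.

Import Order.TTheory GRing.Theory Num.Theory.
Local Open Scope ring_scope.
Local Open Scope quotient_scope.

(* Real affine spaces with director space V, not assumed finite-dimensional
   here: Quad_m A, whose director space is Aff A, is an instance below.
   avec P Q is the vector from P to Q. *)
HB.mixin Record isAffineSpace (R : realType) (V : lmodType R) (A : Type) := {
  atrans : A -> V -> A;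
  avec : A -> A -> V;
  atrans0 : forall P, atrans P 0 = P;
  atransD : forall P u v, atrans P (u + v) = atrans (atrans P u) v;
  avecK : forall P Q, atrans P (avec P Q) = Q;
  atransK : forall P u, avec P (atrans P u) = u;
  affine_nonempty : inhabited A
}.

#[short(type="affineType")]
HB.structure Definition AffineSpace (R : realType) (V : lmodType R) :=
  {A of isAffineSpace R V A}.

Section AffineMaps.
Variables (R : realType) (V : lmodType R) (A : affineType V).
Implicit Types (P Q : A) (W : lmodType R).

(* The barycenter a P + b Q, for a = 1 - b. *)
Definition bary (b : R) P Q : A := atrans P (b *: avec P Q).

Definition affine_map W (f : A -> W) :=
  forall (a b : R) P Q, a + b = 1 -> f (bary b P Q) = a *: f P + b *: f Q.

Definition quadratic_map W (f : A -> W) :=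
  forall (a b : R) P Q, a + b = 1 ->
    f (bary b P Q) = (a * (a - b)) *: f P + (b * (b - a)) *: f Q
                     + (4 * a * b) *: f (bary 2^-1 P Q).

Lemma affine_quadratic W (f : A -> W) : affine_map f -> quadratic_map f.
Proof.
move=> Hf a b P Q ab; rewrite (Hf _ _ P Q ab) (Hf 2^-1 2^-1 P Q); last by field.
rewrite scalerDr !scalerA addrACA -!scalerDl.
have -> : a = 1 - b by rewrite -ab addrK.
by congr (_ *: _ + _ *: _); field.
Qed.

Definition affb : {pred A -> R^o} := fun f => `[< affine_map f >].
Definition quadb : {pred A -> R^o} := fun f => `[< quadratic_map f >].

Lemma affb_submod : submod_closed affb.
Proof.
split=> [|c f g /asboolP Hf /asboolP Hg]; apply/asboolP => a b P Q ab.
  by rewrite !scaler0 addr0.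
have key (x y x' y' : R) : c * (a * x + b * y) + (a * x' + b * y')
  = a * (c * x + x') + b * (c * y + y') by ring.
by apply: etrans (key _ _ _ _); congr (c * _ + _); [exact: Hf | exact: Hg].
Qed.

Lemma quadb_submod : submod_closed quadb.
Proof.
split=> [|c f g /asboolP Hf /asboolP Hg]; apply/asboolP => a b P Q ab.
  by rewrite !scaler0 !addr0.
have key (a1 a2 a3 x y z x' y' z' : R) :
  c * (a1 * x + a2 * y + a3 * z) + (a1 * x' + a2 * y' + a3 * z')
  = a1 * (c * x + x') + a2 * (c * y + y') + a3 * (c * z + z') by ring.
by apply: etrans (key _ _ _ _ _ _ _ _ _); congr (c * _ + _); [exact: Hf | exact: Hg].
Qed.

HB.instance Definition _ := GRing.isSubmodClosed.Build R (A -> R^o) affb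
  affb_submod.
HB.instance Definition _ := GRing.isSubmodClosed.Build R (A -> R^o) quadb
  quadb_submod.

Record Aff := MkAff { aff_fun :> A -> R^o; affP : aff_fun \in affb }.
HB.instance Definition _ := [isSub for aff_fun].
HB.instance Definition _ := [Choice of Aff by <:].
HB.instance Definition _ := [SubChoice_isSubLmodule of Aff by <:].

Record Quad := MkQuad { quad_fun :> A -> R^o; quadP : quad_fun \in quadb }.
HB.instance Definition _ := [isSub for quad_fun].
HB.instance Definition _ := [Choice of Quad by <:].
HB.instance Definition _ := [SubChoice_isSubLmodule of Quad by <:].

Lemma aff_quadb (f : Aff) : (f : A -> R^o) \in quadb.
Proof. by apply/asboolP/affine_quadratic/asboolP/affP. Qed.

Definition quad_of_aff (f : Aff) : Quad := MkQuad (aff_quadb f).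

Definition quad_affb : {pred Quad} := fun f => (f : A -> R^o) \in affb.

Lemma quad_affb_submod : submod_closed quad_affb.
Proof.
split=> [|c f g Hf Hg]; first exact: (rpred0 affb).
exact: (affb_submod.2 c _ _ Hf Hg).
Qed.

HB.instance Definition _ := GRing.isSubmodClosed.Build R Quad quad_affb
  quad_affb_submod.

(* The quotient Quad A / Aff A. *)
Definition Met := Quotient.quot quad_affb.
HB.instance Definition _ := GRing.Zmodule.on Met.

End AffineMaps.

Arguments affb {R V} A.
Arguments quadb {R V} A.

Section Hessian.
Variables (R : realType) (V : lmodType R) (A : affineType V).

Lemma atrans_inj (P : A) : injective (atrans P).
Proof. by move=> u v /(congr1 (avec P)); rewrite !atransK. Qed.

Lemma avec_trans (O : A) u v : avec (atrans O u) (atrans O v) = v - u.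
Proof.
apply: (@atrans_inj (atrans O u)).
by rewrite avecK -atransD addrCA subrr addr0.
Qed.

Lemma bary_trans (O : A) b u v :
  bary b (atrans O u) (atrans O v) = atrans O ((1 - b) *: u + b *: v).
Proof.
rewrite /bary avec_trans -atransD scalerBr scalerBl scale1r.
by congr (atrans O _); rewrite addrCA addrC.
Qed.

(* bary (-1) P Q is 2 P - Q. *)
Definition is_hess (d : A -> R) (g : V -> V -> R) :=
  forall P Q : A,
    1 / 2 * (d Q + d (bary (-1) P Q)) - d P = 1 / 2 * g (avec P Q) (avec P Q).

Lemma quad_plane (F : R -> R -> R) :
    (forall s a b a' b',
       F ((1 - s) * a + s * a') ((1 - s) * b + s * b')
       = (1 - s) * (1 - s - s) * F a b + s * (s - (1 - s)) * F a' b'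
         + 4 * (1 - s) * s * F ((a + a') / 2) ((b + b') / 2)) ->
  (F 1 1 + F (-1) 1 - 2 * F 0 1 = F 2 0 - 2 * F 1 0 + F 0 0)
  /\ forall t, F t 1 - F t 0 - F 0 1 + F 0 0
               = t * (F 1 1 - F 1 0 - F 0 1 + F 0 0).
Proof.
move=> HF.
have L a b x y t : F (a + t * x) (b + t * y)
   = (1 - t / 2) * (1 - t) * F a b + t / 2 * (t - 1) * F (a + 2 * x) (b + 2 * y)
     + t * (2 - t) * F (a + x) (b + y).
  have := HF (t / 2) a b (a + 2 * x) (b + 2 * y).
  rewrite (_ : _ + t / 2 * (a + 2 * x) = a + t * x); last by field.
  rewrite (_ : _ + t / 2 * (b + 2 * y) = b + t * y); last by field.
  rewrite (_ : (a + (a + 2 * x)) / 2 = a + x); last by field.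
  rewrite (_ : (b + (b + 2 * y)) / 2 = b + y); last by field.
  by move=> ->; field.
have X t : F t 0 = (1 - t / 2) * (1 - t) * F 0 0 + t / 2 * (t - 1) * F 2 0
                   + t * (2 - t) * F 1 0.
  by have := L 0 0 1 0 t; rewrite !mulr0 !mulr1 !add0r.
have Y t : F 0 t = (1 - t / 2) * (1 - t) * F 0 0 + t / 2 * (t - 1) * F 0 2
                   + t * (2 - t) * F 0 1.
  by have := L 0 0 0 1 t; rewrite !mulr0 !mulr1 !add0r.
have D : F (3 / 2) 2^-1 = - (1 / 8) * F 0 2 + 3 / 8 * F 2 0 + 3 / 4 * F 1 1.
  have := L 0 2 1 (-1) (3 / 2).
  rewrite (_ : 0 + 3 / 2 * 1 = 3 / 2); last by field.
  rewrite (_ : 2 + 3 / 2 * (-1) = 2^-1); last by field.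
  rewrite (_ : 0 + 2 * 1 = 2); last by field.
  rewrite (_ : 2 + 2 * (-1) = 0); last by field.
  rewrite (_ : 0 + 1 = 1); last by field.
  rewrite (_ : 2 + -1 = 1); last by field.
  by move=> ->; field.
have E : F 2 1 = F 2 0 + 2 * F 1 1 - 2 * F 1 0 - F 0 1 + F 0 0.
  have := L 0 (-1) 1 1 (3 / 2).
  rewrite (_ : 0 + 3 / 2 * 1 = 3 / 2); last by field.
  rewrite (_ : -1 + 3 / 2 * 1 = 2^-1); last by field.
  rewrite (_ : 0 + 2 * 1 = 2); last by field.
  rewrite (_ : -1 + 2 * 1 = 1); last by field.
  rewrite (_ : 0 + 1 = 1); last by field.
  rewrite (_ : -1 + 1 = 0); last by field.
  rewrite D (Y (-1)); lra.
have Z t : F t 1 = (1 - t / 2) * (1 - t) * F 0 1 + t / 2 * (t - 1) * F 2 1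
                   + t * (2 - t) * F 1 1.
  by have := L 0 1 1 0 t; rewrite !mulr0 !mulr1 !add0r !addr0.
split; first by rewrite (Z (-1)) E; field.
by move=> t; rewrite Z X E; field.
Qed.

Lemma hess_exists (d : Quad A) : exists g : {symmetric V}, is_hess d g.
Proof.
have [O] := @affine_nonempty _ _ A.
pose f (u : V) : R := d (atrans O u).
have Hd : quadratic_map (d : A -> R^o) by apply/asboolP/quadP.
have fL s u v : f ((1 - s) *: u + s *: v)
    = (1 - s) * (1 - s - s) * f u + s * (s - (1 - s)) * f v
      + 4 * (1 - s) * s * f (2^-1 *: (u + v)).
  rewrite /f -bary_trans (Hd (1 - s)) ?subrK // bary_trans.
  rewrite (_ : 1 - 2^-1 = 2^-1 :> R); last by field.
  by rewrite -scalerDr.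
have fP u v := quad_plane (F := fun a b => f (a *: u + b *: v)).
have {}fP u v : (f (v + u) + f (v - u) - 2 * f v = f (u + u) - 2 * f u + f 0)
  /\ forall t, f (t *: u + v) - f (t *: u) - f v + f 0
               = t * (f (u + v) - f u - f v + f 0).
  have [|] := fP u v.
    move=> s a b a' b'.
    have -> : ((1 - s) * a + s * a') *: u + ((1 - s) * b + s * b') *: v
            = (1 - s) *: (a *: u + b *: v) + s *: (a' *: u + b' *: v).
      by rewrite !scalerDr !scalerA !scalerDl addrACA.
    rewrite fL; congr (_ + _ * f _).
    by rewrite addrACA -!scalerDl scalerDr !scalerA ![2^-1 * _]mulrC.
  rewrite !scale0r !scale1r !scaleN1r !add0r !addr0 scaler_nat mulr2n.
  rewrite (addrC u v) (addrC (- u) v) => -> H; split=> // t.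
  by have := H t; rewrite ?scale0r ?scale1r !addr0.
have Sd u v : f (v + u) + f (v - u) - 2 * f v = f u + f (- u) - 2 * f 0.
  by have [-> _] := fP u v; have [] := fP u 0; rewrite !add0r => -> _.
pose B u v := f (u + v) - f u - f v + f 0.
have BC u v : B u v = B v u by rewrite /B (addrC u v); ring.
have Bp p u v : B u v = f (p + u + v) - f (p + u) - f (p + v) + f p.
  pose h := 2^-1 *: (u + v).
  pose k := 2^-1 *: (u - v).
  have h2 : h + h = u + v.
    by rewrite -mulr2n -scaler_nat scalerA mulfV ?scale1r ?pnatr_eq0.
  have hk : h + k = u.
    rewrite /h /k -scalerDr addrACA subrr addr0 -mulr2n -scaler_nat scalerA.
    by rewrite mulVf ?scale1r ?pnatr_eq0.
  have hk' : h - k = v.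
    by apply: (addrI u); rewrite -{1}hk addrACA subrr addr0 h2.
  have T q : f (q + u + v) - f (q + u) - f (q + v) + f q
     = (f h + f (- h) - 2 * f 0) - (f k + f (- k) - 2 * f 0).
    rewrite -(Sd h (q + h)) -(Sd k (q + h)).
    rewrite -!(addrA q) h2 hk hk' subrr addr0; ring.
  by rewrite T -(T 0) /B !add0r.
have BD u v w : B (u + v) w = B u w + B v w.
  rewrite (Bp v u w) (addrC v u) /B; ring.
have BZ t u v : B (t *: u) v = t * B u v by have [_ H] := fP u v; exact: H.
have BNl w : zmod_morphism (B ^~ w).
  by move=> u v; rewrite BD -scaleN1r BZ mulN1r.
have BNr w : zmod_morphism (B w).
  by move=> u v; rewrite !(BC w) BNl.
have BZl w : scalable_for *%R (B ^~ w) by move=> t u; exact: BZ.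
have BZr w : scalable_for (idfun \; *%R) (B w).
  by move=> t u; rewrite !(BC w) BZ.
have BH u v : B u v = (-1) ^+ false * idfun (B v u) by rewrite mul1r /= BC.
pose g : {symmetric V} := HB.pack B
  (isBilinear.Build R V V R *%R (idfun \; *%R) B BNl BNr BZl BZr)
  (isHermitianSesquilinear.Build R V false idfun B BH).
exists g => P Q; rewrite -(avecK O P) -(avecK O Q).
move: (avec O P) (avec O Q) => p q; rewrite avec_trans bary_trans.
have [w ->] : exists w, q = p + w by exists (q - p); rewrite addrCA subrr addr0.
have -> : p + w - p = w by rewrite addrAC subrr add0r.
have -> : (1 - -1) *: p + -1 *: (p + w) = p - w.
  by rewrite opprK scalerDl scale1r scaleN1r opprD addrA addrK.
rewrite -/(f _) -/(f _) -/(f p) [g _ _]/(B _ _).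
by have [Hw _] := fP w p; move: Hw; rewrite /B; lra.
Qed.

Definition hess (d : Quad A) : {symmetric V} := projT1 (cid (hess_exists d)).

Lemma hessP (d : Quad A) : is_hess d (hess d).
Proof. exact: projT2 (cid (hess_exists d)). Qed.

Lemma hess_unique (d : A -> R) (g g' : {symmetric V}) :
  is_hess d g -> is_hess d g' -> g =2 g'.
Proof.
have [P] := @affine_nonempty _ _ A.
move=> Hg Hg'.
have E u : g u u = g' u u.
  have := Hg P (atrans P u); rewrite Hg' !atransK; lra.
have S (h : {symmetric V}) u v : h (u + v) (u + v) = h u u + 2 * h u v + h v v.
  rewrite linearDl !linearDr /= (hermitian_subproof v u) mul1r /=; ring.
move=> u v; have := E (u + v); rewrite !S !E; lra.
Qed.

(* The hessian is constant on the classes modulo Aff A (met_hessE), so the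
   choice of representative is immaterial. *)
Definition met_hess (m : Met A) : {symmetric V} := hess (repr m).

Lemma met_hessE (m : Met A) (d : Quad A) :
  \pi_(Met A) d = m -> hess d =2 met_hess m.
Proof.
move=> dm; apply: (@hess_unique d); first exact: hessP.
move=> P Q; rewrite -(hessP (repr m)).
have /asboolP Ha : ((d - repr m : Quad A) : A -> R^o) \in affb A.
  have: d == repr m %[mod Met A] by rewrite reprK dm.
  by rewrite -Quotient.idealrBE.
have := Ha 2 (-1) P Q; rewrite (_ : 2 + -1 = 1); last by ring.
move/(_ erefl).
have E X : ((d - repr m : Quad A) : A -> R^o) X = (d X : R) - (repr m X : R).
  by [].
rewrite !E /GRing.scale /=.
move: (d _) (d _) (d _) (repr m _) (repr m _) (repr m _) => x y z x' y' z'.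
by move=> H; have {H} : (z : R) - z' = 2 * (y - y') + -1 * (x - x') := H; lra.
Qed.

End Hessian.

Section QuadM.
Variables (R : realType) (V : lmodType R) (A : affineType V) (m : Met A).

Record QuadM :=
  MkQuadM { quadM_quad :> Quad A; quadMP : \pi_(Met A) quadM_quad == m }.
HB.instance Definition _ := [isSub for quadM_quad].
HB.instance Definition _ := [Choice of QuadM by <:].

Lemma quadM_trans_subproof (d : QuadM) (a : Aff A) :
  \pi_(Met A) (quadM_quad d + quad_of_aff a) == m.
Proof.
rewrite -(eqP (quadMP d)) -Quotient.idealrBE addrAC subrr add0r.
exact: affP.
Qed.

Lemma quadM_vec_subproof (d e : QuadM) :
  ((quadM_quad e - quadM_quad d : Quad A) : A -> R^o) \in affb A.
Proof.
have: quadM_quad e == quadM_quad d %[mod Met A].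
  by rewrite (eqP (quadMP e)) (eqP (quadMP d)).
by rewrite -Quotient.idealrBE.
Qed.

Definition quadM_trans (d : QuadM) (a : Aff A) : QuadM :=
  MkQuadM (quadM_trans_subproof d a).
Definition quadM_vec (d e : QuadM) : Aff A := MkAff (quadM_vec_subproof d e).

Lemma quadM_trans0 d : quadM_trans d 0 = d.
Proof.
do 2! apply: val_inj => /=; apply/funext => P.
by rewrite [LHS]addr0.
Qed.

Lemma quadM_transD d a b :
  quadM_trans d (a + b) = quadM_trans (quadM_trans d a) b.
Proof.
do 2! apply: val_inj => /=; apply/funext => P.
by rewrite [LHS]addrA.
Qed.

Lemma quadM_vecK d e : quadM_trans d (quadM_vec d e) = e.
Proof.
do 2! apply: val_inj => /=; apply/funext => P.
by rewrite [LHS]addrC [LHS]subrK.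
Qed.

Lemma quadM_transK d a : quadM_vec d (quadM_trans d a) = a.
Proof.
apply: val_inj => /=; apply/funext => P.
by rewrite [LHS]addrAC [X in X + _]subrr add0r.
Qed.

Lemma quadM_nonempty : inhabited QuadM.
Proof. by constructor; exists (repr m); rewrite reprK. Qed.

HB.instance Definition _ := isAffineSpace.Build R (Aff A) QuadM
  quadM_trans0 quadM_transD quadM_vecK quadM_transK quadM_nonempty.

Lemma quadM_bary (b : R) (d e : QuadM) (P : A) :
  bary b d e P = d P + b * (e P - d P) :> R.
Proof. by []. Qed.

(* evP P and evm are the affine functionals v_P and v_m. *)
Definition evP_fun (P : A) : QuadM -> R^o := fun d => d P.

Lemma evP_affb P : evP_fun P \in affb QuadM.
Proof.
apply/asboolP => a b d e ab; rewrite /evP_fun quadM_bary.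
have -> : a = 1 - b by rewrite -ab addrK.
have key (x y : R) : x + b * (y - x) = (1 - b) * x + b * y by ring.
exact: key.
Qed.

Definition evP (P : A) : Aff QuadM := MkAff (evP_affb P).

Lemma evm_affb : ((fun=> 1) : QuadM -> R^o) \in affb QuadM.
Proof. by apply/asboolP => a b d e ab; rewrite -scalerDl ab scale1r. Qed.

Definition evm : Aff QuadM := MkAff evm_affb.

End QuadM.

(* The algebraic dual; 'Hom(U, R^o) would require a vectType structure on U. *)
Section LinearDual.
Variables (R : realType) (U : lmodType R).

Definition linb : {pred U -> R^o} := fun f => `[< linear f >].

Lemma linb_submod : submod_closed linb.
Proof.
split=> [|c f g /asboolP Hf /asboolP Hg]; apply/asboolP => a u v.
  by rewrite scaler0 addr0.
have key (x y x' y' : R) : c * (a * x + y) + (a * x' + y')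
  = a * (c * x + x') + (c * y + y') by ring.
by apply: etrans (key _ _ _ _); congr (c * _ + _); [exact: Hf | exact: Hg].
Qed.

HB.instance Definition _ := GRing.isSubmodClosed.Build R (U -> R^o) linb
  linb_submod.

Record ldual := MkLdual { ldual_fun :> U -> R^o; ldualP : ldual_fun \in linb }.
HB.instance Definition _ := [isSub for ldual_fun].
HB.instance Definition _ := [Choice of ldual by <:].
HB.instance Definition _ := [SubChoice_isSubLmodule of ldual by <:].

Lemma ldual_linear (f : ldual) : linear f.
Proof. exact/asboolP/ldualP. Qed.

HB.instance Definition _ (f : ldual) :=
  GRing.isLinear.Build R U R^o *:%R f (ldual_linear f).

End LinearDual.

Arguments linb {R} U.

Section Hull.
Variables (R : realType) (V : lmodType R) (A : affineType V) (m : Met A).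

(* The linear hull of Quad_m A is the dual of its space of affine functions. *)
Definition hull : lmodType R := ldual (Aff (QuadM m)).

Lemma hull_embed_linb (d : QuadM m) :
  ((fun f => f d) : Aff (QuadM m) -> R^o) \in linb (Aff (QuadM m)).
Proof. exact/asboolP. Qed.

Definition hull_embed (d : QuadM m) : hull := MkLdual (hull_embed_linb d).

End Hull.

(* Main.v *)
Require Import Defs.
From HB Require Import structures.
From mathcomp Require Import all_boot all_order all_algebra.
From mathcomp Require Import sesquilinear boolp functions reals.
From mathcomp Require Import ring_quotient generic_quotient ring lra.

Set Implicit Arguments.
Unset Strict Implicit.
Unset Printing Implicit Defensive.

Import GRing.Theory Num.Theory.
Local Open Scope ring_scope.

(** Everything is read off from identities between the functionals v_P and v_m
    in Aff (Quad_m A), to which an element of the hull, being linear on that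
    space, can be applied.

    The barycentric identity that makes each element of Quad_m A quadratic says
    that P |-> v_P is quadratic, so its composite with a linear form is a
    quadratic function.  The elements of Quad_m A have the common hessian g_m,
    which says that (v_Q + v_(2P-Q)) / 2 - v_P = g_m(PQ, PQ) / 2 * v_m
    (evP_second_difference); applying a point of the hull yields the hessian of
    its image, on the diagonal and hence, by polarization, everywhere.

    What remains is that a point of the hull with value 1 on v_m is evaluation
    at some d in Quad_m A.  The candidate is d = its image: it has hessian g_m,
    hence differs from a member of the class m by a quadratic function without
    hessian, which is affine (affine_of_hess0).  That evaluation at d is the
    given point follows because v_m and the v_P span Aff (Quad_m A)
    (aff_quadM_span).  This is where the finite dimension enters: an affine
    function on A is determined by its values at the finitely many points of an
    affine frame, so that every linear form on Aff A is a combination of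
    evaluations. *)

(** * Affine functions in coordinates *)

Section AffineFunctions.
Variables (R : realType) (V : lmodType R) (A : affineType V).

Lemma aff_ext (f g : Aff A) : (forall P, f P = g P) -> f = g.
Proof. by move=> fg; apply: val_inj; apply/funext. Qed.

Lemma aff_sumE n (f : 'I_n -> Aff A) P :
  (\sum_i f i : Aff A) P = \sum_i (f i P : R).
Proof. by apply: (big_morph (fun h : Aff A => h P : R)). Qed.

(** O + (c u + v) is the midpoint of O + 2 c u and O + 2 v, and each of these
    lies on a line through O. *)
Lemma aff_linear_part (f : Aff A) (O : A) :
  linear (fun u => f (atrans O u) - f O : R^o).
Proof.
have /asboolP Hf := affP f.
have line t u : (f (atrans O (t *: u)) : R)
    = (1 - t) * f O + t * f (atrans O u).
  have := Hf (1 - t) t O (atrans O u).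
  by rewrite /bary atransK subrK => /(_ erefl).
move=> c u v.
have := Hf 2^-1 2^-1 (atrans O ((2 * c) *: u)) (atrans O (2 *: v)).
rewrite bary_trans (_ : 1 - 2^-1 = 2^-1 :> R); last by field.
have half w : 2^-1 *: (2 *: w) = w :> V.
  by rewrite scalerA mulVf ?scale1r ?pnatr_eq0.
rewrite -[(2 * c) *: u]scalerA !half scalerA.
rewrite (_ : 2^-1 + 2^-1 = 1 :> R); last by field.
move=> /(_ erefl) ->; rewrite !line /GRing.scale /=.
have key (x y z : R) :
     2^-1 * ((1 - 2 * c) * z + 2 * c * x) + 2^-1 * ((1 - 2) * z + 2 * y) - z
     = c * (x - z) + (y - z) by field.
exact: key.
Qed.

Lemma linear_affb (L : {linear V -> R^o}) (O : A) :
  (fun P => L (avec O P)) \in affb A.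
Proof.
apply/asboolP => a b P Q ab.
rewrite -(avecK O P) -(avecK O Q) bary_trans !atransK linearD !linearZ /=.
by rewrite -ab addrK.
Qed.

Lemma cst_affb (c : R) : (fun=> c : R^o) \in affb A.
Proof. by apply/asboolP => a b P Q ab; rewrite -scalerDl ab scale1r. Qed.

Definition aff_of_linear L O : Aff A := MkAff (linear_affb L O).
Definition aff_cst c : Aff A := MkAff (cst_affb c).

End AffineFunctions.

Section AffineFrame.
Variables (R : realType) (V : vectType R) (A : affineType V).
Let n := \dim (fullv : {vspace V}).
Let e (i : 'I_n) : V := (vbasis fullv)`_i.

Definition frame_point (O : A) (i : 'I_n) : A := atrans O (e i).

Definition frame_coord (O : A) (i : 'I_n) : Aff A :=
  aff_of_linear (coord (vbasis fullv) i : {linear V -> R^o}) O.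

(** Interpolation of an affine function from its values on a frame. *)
Lemma aff_frame (O : A) (f : Aff A) :
  f = f O *: aff_cst A 1
      + \sum_i (f (frame_point O i) - f O) *: frame_coord O i.
Proof.
pose L : {linear V -> R^o} := HB.pack (fun u => f (atrans O u) - f O : R^o)
  (GRing.isLinear.Build R V R^o *:%R _ (aff_linear_part f O)).
apply: aff_ext => P.
have -> : (f P : R) = f O + L (avec O P).
  by rewrite /L /= avecK addrC subrK.
rewrite {1}(coord_vbasis (memvf (avec O P))) linear_sum.
transitivity ((f O : R) * 1 + (\sum_i (f (frame_point O i) - f O)
   *: frame_coord O i : Aff A) P); last by [].
rewrite mulr1 aff_sumE; congr (_ + _); apply: eq_bigr => i _.
by rewrite linearZ; exact: mulrC.
Qed.

End AffineFrame.

(** * Hessians *)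

Section Hessians.
Variables (R : realType) (V : lmodType R) (A : affineType V).

(** Without second differences, the value at a midpoint is the mean, and the
    quadratic barycentric formula reduces to the affine one. *)
Lemma affine_of_hess0 (d : Quad A) :
  is_hess d (fun _ _ => 0) -> (d : A -> R^o) \in affb A.
Proof.
move=> d0; apply/asboolP => a b P Q ab.
have /asboolP Hd := quadP d.
have reflect_mid : bary (-1) (bary 2^-1 P Q) P = Q.
  rewrite [bary 2^-1 P Q]/bary -[X in bary _ _ X](atrans0 P) bary_trans.
  rewrite scaler0 addr0 scalerA (_ : (1 - -1) * 2^-1 = 1 :> R); last by field.
  by rewrite scale1r avecK.
have mid : d (bary 2^-1 P Q) = (d P + d Q) / 2 :> R.
  by have := d0 (bary 2^-1 P Q) P; rewrite reflect_mid; lra.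
rewrite (Hd a b P Q ab) mid /GRing.scale /=.
have -> : a = 1 - b by rewrite -ab addrK.
have key (x y : R) : (1 - b) * (1 - b - b) * x + b * (b - (1 - b)) * y
   + 4 * (1 - b) * b * ((x + y) / 2) = (1 - b) * x + b * y by field.
exact: key.
Qed.

Lemma eq_class_of_hess (d e : Quad A) :
  hess d =2 hess e -> (\pi_(Met A) d = \pi_(Met A) e)%qT.
Proof.
move=> de; apply/eqP; rewrite -Quotient.idealrBE.
apply: affine_of_hess0 => P Q.
have := hessP d P Q; rewrite de -(hessP e P Q).
have E X : ((d - e : Quad A) X : R) = (d X : R) - (e X : R) by [].
rewrite !E; lra.
Qed.

(** Polarization makes the diagonal determine the form; it avoids exhibiting
    c g' as a symmetric form in order to use the uniqueness of hessians. *)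
Lemma symmetric_diag_scale (c : R) (g g' : {symmetric V}) :
  (forall u, g u u = c * g' u u) -> forall u w, g u w = c * g' u w.
Proof.
move=> gg' u w.
have S (h : {symmetric V}) : h (u + w) (u + w) = h u u + 2 * h u w + h w w.
  rewrite linearDl !linearDr /= (hermitian_subproof w u) mul1r /=; ring.
have := gg' (u + w); rewrite !S !gg'; lra.
Qed.

End Hessians.

(** * The space of affine functionals on a class of quadratic functions *)

Section Evaluations.
Variables (R : realType) (V : lmodType R) (A : affineType V) (m : Met A).

Lemma evP_quadratic : quadratic_map (fun P : A => evP m P).
Proof.
move=> a b P Q ab; apply: aff_ext => d.
have /asboolP Hd := quadP d.
exact: Hd.
Qed.

Lemma evP_second_difference (P Q : A) :
  (1 / 2) *: (evP m Q + evP m (bary (-1) P Q)) - evP m P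
  = (1 / 2 * met_hess m (avec P Q) (avec P Q)) *: evm m.
Proof.
apply: aff_ext => d.
transitivity (1 / 2 * met_hess m (avec P Q) (avec P Q) * 1); last by [].
by rewrite mulr1 -(met_hessE (eqP (quadMP d))) -(hessP d P Q).
Qed.

Lemma hull_quadb (dh : hull m) : (fun P : A => dh (evP m P)) \in quadb A.
Proof.
apply/asboolP => a b P Q ab.
by rewrite (evP_quadratic P Q ab) !linearD !linearZ.
Qed.

Definition hull_quad (dh : hull m) : Quad A := MkQuad (hull_quadb dh).

Lemma hull_quad_linear : linear hull_quad.
Proof. by move=> c dh dh'; apply: val_inj; apply/funext. Qed.

Lemma hess_hull_quad (dh : hull m) (u w : V) :
  hess (hull_quad dh) u w = dh (evm m) * met_hess m u w.
Proof.
have [P] := @affine_nonempty _ _ A.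
apply: symmetric_diag_scale => {w}u.
have := hessP (hull_quad dh) P (atrans P u).
have := congr1 dh (evP_second_difference P (atrans P u)).
rewrite linearB !linearZ linearD /= atransK /GRing.scale /= => -> H.
by lra.
Qed.

Lemma hull_quad_embed (d : QuadM m) : hull_quad (hull_embed d) = quadM_quad d.
Proof. by apply: val_inj; apply/funext. Qed.

End Evaluations.

Section Span.
Variables (R : realType) (V : vectType R) (A : affineType V) (m : Met A).

(** The linear part of f is a linear form on Aff A, hence determined by its
    values on the frame functions; the coefficients of interpolation are
    themselves values at points of the frame, that is, evaluations. *)
Lemma aff_quadM_span (O : A) (f : Aff (QuadM m)) :
  exists (k l : R) (mu : 'I_(\dim (fullv : {vspace V})) -> R),
    f = k *: evm m + l *: evP m O + \sum_i mu i *: evP m (frame_point O i).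
Proof.
have [d0] := @affine_nonempty _ _ (QuadM m).
pose L : {linear Aff A -> R^o} :=
  HB.pack (fun a => f (atrans d0 a) - f d0 : R^o)
  (GRing.isLinear.Build R (Aff A) R^o *:%R _ (aff_linear_part f d0)).
(* Interpolating a = d - d0 in f d = f d0 + L a puts values of d in the
   combination; the matching values of d0 are constants, absorbed in the
   coefficient of v_m. *)
pose mu i : R := L (frame_coord O i).
pose l : R := L (aff_cst A 1) - \sum_i mu i.
exists (f d0 - d0 O * l - \sum_i mu i * d0 (frame_point O i)), l, mu.
apply: aff_ext => d.
have -> : (f d : R) = f d0 + L (avec d0 d) by rewrite /L /= avecK addrC subrK.
rewrite (aff_frame O (avec d0 d)) linearD linearZ linear_sum.
transitivity ((f d0 - d0 O * l - \sum_i mu i * d0 (frame_point O i)) * 1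
  + l * d O + (\sum_i mu i *: evP m (frame_point O i) : Aff (QuadM m)) d);
  last by [].
rewrite aff_sumE.
have -> : \sum_i L ((avec d0 d (frame_point O i) - avec d0 d O)
             *: frame_coord O i)
  = \sum_i mu i * d (frame_point O i) - \sum_i mu i * d0 (frame_point O i)
    - (d O - d0 O) * \sum_i mu i :> R.
  rewrite mulr_sumr -!sumrB; apply: eq_bigr => i _; rewrite linearZ.
  have key (x y z : R) : (x - y - z) * mu i = mu i * x - mu i * y - z * mu i.
    by ring.
  exact: key.
rewrite (_ : L (aff_cst A 1) = l + \sum_i mu i :> R); last by rewrite subrK.
rewrite /GRing.scale /=.
move: (\sum_i mu i) (\sum_i mu i * d0 _) (\sum_i mu i * d _) => s0 s1 s2.
have key (x x0 y : R) : y + ((x - x0) * (l + s0) + (s2 - s1 - (x - x0) * s0))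
   = (y - x0 * l - s1) * 1 + l * x + s2 by ring.
exact: key.
Qed.

(** The two kinds of functionals span, so they separate points of the hull. *)
Lemma hull_ext (dh dh' : hull m) :
  dh (evm m) = dh' (evm m) -> (forall P, dh (evP m P) = dh' (evP m P)) ->
  dh = dh'.
Proof.
move=> Em EP; have [O] := @affine_nonempty _ _ A.
apply: val_inj; apply/funext => f /=.
have [k [l [mu ->]]] := aff_quadM_span O f.
rewrite !linearD !linearZ !linear_sum /= Em EP; congr (_ + _).
by apply: eq_bigr => i _; rewrite !linearZ /= EP.
Qed.

Lemma hull_hyperplane (dh : hull m) :
  dh (evm m) = 1 <-> exists d : QuadM m, dh = hull_embed d.
Proof.
split=> [dh1 | [d ->] //].
have dm : (\pi_(Met A) (hull_quad dh) == m)%qT.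
  rewrite -[m in X in _ == X]reprK; apply/eqP/eq_class_of_hess => u w.
  by rewrite hess_hull_quad dh1 mul1r.
exists (MkQuadM dm); exact: hull_ext.
Qed.

End Span.

(** * The hull as a space of quadratic functions *)

Theorem lemma5p4 (R : realType) (V : vectType R) (A : affineType V)
    (m : Met A) :
  quadratic_map (fun P : A => evP m P) /\
  exists Phi : {linear hull m -> Quad A},
    [/\ forall (dh : hull m) (P : A), Phi dh P = dh (evP m P),
        forall dh : hull m,
          dh (evm m) = 1 <-> exists d : QuadM m, dh = hull_embed d,
        forall d : QuadM m, Phi (hull_embed d) = quadM_quad d
      & forall (dh : hull m) (u w : V),
          hess (Phi dh) u w = dh (evm m) * met_hess m u w].
Proof.
split; first exact: evP_quadratic.
pose Phi : {linear hull m -> Quad A} := HB.pack (@hull_quad R V A m)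
  (GRing.isLinear.Build R (hull m) (Quad A) *:%R _ (@hull_quad_linear R V A m)).
exists Phi; split=> //.
- exact: hull_hyperplane.
- exact: hull_quad_embed.
- exact: hess_hull_quad.
Qed.
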